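(* Let $G$ and $H$ be polycyclic by finite groups. If $G$ and $H$ act on each other compatibly, then the non-abelian tensor product $G\otimes H$ is polycyclic by finite. In particular, $G\otimes H$ is a Noetherian group.
   Context: A group is polycyclic by finite if it has a polycyclic normal subgroup of finite index. A group is Noetherian if all of its subgroups are finitely generated. Groups act on themselves by conjugation on the left: ${}^{g}g'=gg'g^{-1}$. Let $G$ act on $H$ and $H$ act on $G$ by automorphisms (left actions, written ${}^{g}h$ and ${}^{h}g$). The mutual actions are compatible if ${}^{({}^{h}g)}h'={}^{hgh^{-1}}h'$ and ${}^{({}^{g}h)}g'={}^{ghg^{-1}}g'$ for all $g,g'\in G$, $h,h'\in H$, where ${}^{hgh^{-1}}h'$ means $h\cdot {}^{g}(h^{-1}h'h)\cdot h^{-1}$ and ${}^{ghg^{-1}}g'$ means $g\cdot {}^{h}(g^{-1}g'g)\cdot g^{-1}$. For compatible actions, the non-abelian tensor product $G\otimes H$ is the group generated by symbols $g\otimes h$ ($g\in G$, $h\in H$) with relations $gg'\otimes h=({}^{g}g'\otimes {}^{g}h)(g\otimes h)$ and $g\otimes hh'=(g\otimes h)({}^{h}g\otimes {}^{h}h')$ for all $g,g'\in G$, $h,h'\in H$. *)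

(* Defs.v *)
(* Groups are arbitrary, possibly infinite, [groupType]s; subsets of a group are
   Prop-valued ([set G]). *)
From HB Require Import structures.
From mathcomp Require Import all_boot all_order ssralg ssrint.
From mathcomp Require Import boolp classical_sets functions cardinality.

Set Implicit Arguments.
Unset Strict Implicit.
Unset Printing Implicit Defensive.

Local Open Scope classical_set_scope.
Local Open Scope group_scope.

Section Subgroups.
Variable G : groupType.
Implicit Types (A K L N : set G) (x y : G).

Definition is_subgroup A : Prop :=
  [/\ A 1, forall x y, A x -> A y -> A (x * y) & forall x, A x -> A x^-1].

Definition normal_in K L : Prop :=
  [/\ is_subgroup K, is_subgroup L, K `<=` L &
      forall x y, L x -> K y -> K (x * y * x^-1)].

Definition left_coset K x : set G := [set x * y | y in K].

Definition finite_index K : Prop := finite_set (range (left_coset K)).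

Definition expgz x (k : int) : G :=
  match k with Posz n => x ^+ n | Negz n => x ^- n.+1 end.

(* For K normal in L: the quotient L / K is cyclic, i.e. it consists of the
   powers (x K)^k = x^k K of one of its elements. *)
Definition cyclic_quotient L K : Prop :=
  exists2 x, L x &
    forall y, L y -> exists k : int, left_coset K y = left_coset K (expgz x k).

(* 1 = S 0 <| S 1 <| ... <| S n = A with cyclic factors S i.+1 / S i. *)
Definition polycyclic A : Prop :=
  exists (n : nat) (S : nat -> set G),
    [/\ S 0%N = [set 1], S n = A &
        forall i, (i < n)%N ->
          normal_in (S i) (S i.+1) /\ cyclic_quotient (S i.+1) (S i)].

Definition generated A : set G := smallest is_subgroup A.

Definition finitely_generated A : Prop :=
  exists s : seq G, generated [set` s] = A.

End Subgroups.

Definition polycyclic_by_finite (G : groupType) : Prop :=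
  exists N : set G, [/\ normal_in N [set: G], polycyclic N & finite_index N].

Definition noetherian (G : groupType) : Prop :=
  forall A : set G, is_subgroup A -> finitely_generated A.

(* Left actions by automorphisms; act g is bijective because act g^-1 is its
   inverse. *)
Definition acts_by_automorphisms (G H : groupType) (act : G -> H -> H) : Prop :=
  [/\ forall h, act 1 h = h,
      forall g g' h, act (g * g') h = act g (act g' h) &
      forall g h h', act g (h * h') = act g h * act g h'].

Definition compatible (G H : groupType)
    (actGH : G -> H -> H) (actHG : H -> G -> G) : Prop :=
  (forall g h h',
     actGH (actHG h g) h' = h * actGH g (h^-1 * h' * h) * h^-1) /\
  (forall g g' h,
     actHG (actGH g h) g' = g * actHG h (g^-1 * g' * g) * g^-1).

(* The group < X | s = t for R s t >: formal group expressions in X modulo the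
   least congruence containing R and the group axioms. *)
Section Presentation.
Variable X : Type.

Inductive gterm : Type :=
| TGen of X
| TOne
| TMul of gterm & gterm
| TInv of gterm.

HB.instance Definition _ := gen_eqMixin gterm.
HB.instance Definition _ := gen_choiceMixin gterm.

Variable R : gterm -> gterm -> Prop.

Inductive gcong : gterm -> gterm -> Prop :=
| gcong_rel s t : R s t -> gcong s t
| gcong_refl s : gcong s s
| gcong_sym s t : gcong s t -> gcong t s
| gcong_trans s t u : gcong s t -> gcong t u -> gcong s u
| gcong_mul s s' t t' :
    gcong s s' -> gcong t t' -> gcong (TMul s t) (TMul s' t')
| gcong_inv s s' : gcong s s' -> gcong (TInv s) (TInv s')
| gcong_mulA s t u : gcong (TMul s (TMul t u)) (TMul (TMul s t) u)
| gcong_mul1 s : gcong (TMul TOne s) s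
| gcong_1mul s : gcong (TMul s TOne) s
| gcong_mulV s : gcong (TMul (TInv s) s) TOne
| gcong_Vmul s : gcong (TMul s (TInv s)) TOne.

Definition gcongb : rel gterm := fun s t => `[< gcong s t >].

Fact gcongb_refl : reflexive gcongb.
Proof. by move=> s; apply/asboolP; exact: gcong_refl. Qed.

Fact gcongb_sym : symmetric gcongb.
Proof.
by move=> s t; apply/asboolP/asboolP; exact: gcong_sym.
Qed.

Fact gcongb_trans : transitive gcongb.
Proof.
by move=> t s u /asboolP st /asboolP tu; apply/asboolP; exact: gcong_trans tu.
Qed.

Canonical gcong_equiv := EquivRel gcongb gcongb_refl gcongb_sym gcongb_trans.

Local Open Scope quotient_scope.

Definition presented : Type := {eq_quot gcong_equiv}.

HB.instance Definition _ := Choice.on presented.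

Local Notation cls := (\pi_({eq_quot gcong_equiv}) : gterm -> presented).

Definition pone : presented := cls TOne.
Definition pmul (a b : presented) : presented :=
  cls (TMul (repr (a : {eq_quot gcong_equiv}))
            (repr (b : {eq_quot gcong_equiv}))).
Definition pinv (a : presented) : presented :=
  cls (TInv (repr (a : {eq_quot gcong_equiv}))).

Fact clsP s t : cls s = cls t <-> gcong s t.
Proof.
split; first by move/(@eqquotP _ gcong_equiv)/asboolP.
by move=> st; apply/(@eqquotP _ gcong_equiv)/asboolP.
Qed.

Fact gcong_repr s : gcong (repr (\pi_({eq_quot gcong_equiv}) s)) s.
Proof. by apply/clsP; rewrite reprK. Qed.

Fact cls_mul s t : pmul (cls s) (cls t) = cls (TMul s t).
Proof. by apply/clsP/gcong_mul; exact: gcong_repr. Qed.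

Fact cls_inv s : pinv (cls s) = cls (TInv s).
Proof. by apply/clsP/gcong_inv; exact: gcong_repr. Qed.

Fact presentedW (P : presented -> Prop) :
  (forall s, P (cls s)) -> forall a, P a.
Proof. by move=> Ps a; rewrite -[a](@reprK _ {eq_quot gcong_equiv}). Qed.

Fact pmulA : associative pmul.
Proof.
elim/presentedW=> s; elim/presentedW=> t; elim/presentedW=> u.
by rewrite !cls_mul; apply/clsP; exact: gcong_mulA.
Qed.

Fact pmul1 : left_id pone pmul.
Proof.
by elim/presentedW=> s; rewrite cls_mul; apply/clsP; exact: gcong_mul1.
Qed.

Fact p1mul : right_id pone pmul.
Proof.
by elim/presentedW=> s; rewrite cls_mul; apply/clsP; exact: gcong_1mul.
Qed.

Fact pmulV : left_inverse pone pinv pmul.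
Proof.
elim/presentedW=> s.
by rewrite cls_inv cls_mul; apply/clsP; exact: gcong_mulV.
Qed.

Fact pVmul : right_inverse pone pinv pmul.
Proof.
elim/presentedW=> s.
by rewrite cls_inv cls_mul; apply/clsP; exact: gcong_Vmul.
Qed.

HB.instance Definition _ :=
  isGroup.Build presented pmulA pmul1 p1mul pmulV pVmul.

End Presentation.

Section TensorProduct.
Variables (G H : groupType) (actGH : G -> H -> H) (actHG : H -> G -> G).

Local Notation "g ⊗ h" := (TGen (g, h)) (at level 40).

Inductive tensor_relation : gterm (G * H) -> gterm (G * H) -> Prop :=
| tensor_mull g g' h :
    tensor_relation ((g * g') ⊗ h)
      (TMul ((g * g' * g^-1) ⊗ actGH g h) (g ⊗ h))
| tensor_mulr g h h' :
    tensor_relation (g ⊗ (h * h'))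
      (TMul (g ⊗ h) (actHG h g ⊗ (h * h' * h^-1))).

Definition nonabelian_tensor : groupType := presented tensor_relation.

End TensorProduct.

(* Main.v *)
From mathcomp Require Import all_boot ssralg ssrnum ssrint intdiv.
From mathcomp Require Import boolp classical_sets cardinality.
From mathcomp Require Import zify.
Require Import Defs.
From mathcomp Require Import monoid.

(** Write T for G ⊗ H.  The map g ⊗ h |-> g (^h g)^-1 extends to a homomorphism
lam : T -> G, and both G and H act on T by automorphisms, diagonally and with
conjugation on the factor of the same name.  Expanding (ab) ⊗ (cd) in the two
possible orders shows that conjugation by t in T is the action of lam t in G
([tensor_conj]), so that ker lam is central.  A second computation gives
lam(t) ⊗ h = t (^h t)^-1 ([tens_to_left]), so that H fixes ker lam pointwise.
As G is Noetherian, lam(T) is finitely generated.  The theorem therefore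
follows from two finiteness statements.

- T is finitely generated ([tensor_fg]).
- A finitely generated central extension T of a subgroup of a
  polycyclic-by-finite group is polycyclic by finite
  ([central_extension_polycyclic_by_finite]).

Both rest on one observation ([fg_stable_subgroup]).  Let M be a group that is
generated by a subset A and a finite set F, in the sense that M = <F> A, and
let finitely many endomorphisms of M fix every element of A.  For each
endomorphism phi and each s in F write phi(s) = w a with w in <F> and a in A.
Adjoining to F these finitely many elements a gives a finitely generated
subgroup that all the endomorphisms preserve, because they do not move the new
generators.  Finitely many further elements of M can be put into it.

For the first statement take M = T, A = ker lam, and the actions of the
generators of H.  The subgroup M0 obtained is invariant under H, and can be
made to contain x ⊗ y for x, y in finite generating sets of G and H.  Since
h |-> x ⊗ h is a crossed homomorphism, M0 contains x ⊗ h for all h in H, and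
since ab ⊗ h = (a ⊗ ^b h)(b ⊗ h), it contains g ⊗ h for all g in G.

For the second statement pull back a subnormal series of a polycyclic subgroup
of finite index.  Schreier's lemma passes finite generation to the finite-index
preimage.  At a step with cyclic factor generated by t, the observation applied
to conjugation by t and its inverse, which fix the central kernel, yields a
finitely generated subgroup M0 of the smaller term with <t> M0 equal to the
larger one, and then M0 is the whole smaller term ([fg_preimage_normal]).  So
finite generation descends to the kernel, a finitely generated abelian group,
and polycyclicity climbs back up the same series. *)

Set Implicit Arguments.
Unset Strict Implicit.
Unset Printing Implicit Defensive.

Local Open Scope classical_set_scope.
Local Open Scope group_scope.

(** * Generated subgroups, cosets and integer powers *)

Section Generation.
Variable G : groupType.
Implicit Types (A B K L M : set G) (x y : G).

Lemma gen_subgroup A : is_subgroup (generated A).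
Proof.
split=> [B [[B1 _ _] _] //|x y Ax Ay B BP|x Ax B BP].
- by case: (BP) => [[_ BM _] _]; apply: BM; [exact: Ax|exact: Ay].
- by case: (BP) => [[_ _ BV] _]; apply: BV; exact: Ax.
Qed.

Lemma sub_gen A : A `<=` generated A.
Proof. exact: sub_gen_smallest. Qed.

Lemma gen_sub A B : is_subgroup B -> A `<=` B -> generated A `<=` B.
Proof. exact: smallest_sub. Qed.

Lemma finitely_generatedP A :
  finitely_generated A <-> exists2 F, finite_set F & generated F = A.
Proof.
split=> [[s <-]|[F /finite_seqP[s ->] <-]]; last by exists s.
by exists [set` s].
Qed.

Lemma subgroupI A B : is_subgroup A -> is_subgroup B -> is_subgroup (A `&` B).
Proof.
move=> [A1 AM AV] [B1 BM BV]; split=> //.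
- by move=> x y [Ax Bx] [Ay By]; split; [exact: AM|exact: BM].
- by move=> x [Ax Bx]; split; [exact: AV|exact: BV].
Qed.

Lemma left_coset_eqP K x y : is_subgroup K ->
  left_coset K x = left_coset K y <-> K (x^-1 * y).
Proof.
move=> [K1 KM KV]; split=> [xy|Kxy].
  have: left_coset K y y by exists 1; rewrite ?mulg1.
  by rewrite -xy => -[k Kk <-]; rewrite mulKg.
apply/seteqP; split=> _ [k Kk <-].
  exists ((x^-1 * y)^-1 * k); first by apply: KM => //; exact: KV.
  by rewrite invgM invgK !mulgA mulgV mul1g.
by exists (x^-1 * y * k); [exact: KM|rewrite !mulgA mulgV mul1g].
Qed.

Lemma finite_indexP K : is_subgroup K -> finite_index K <->
  exists2 R, finite_set R & forall x, exists2 r, R r & K (r^-1 * x).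
Proof.
move=> sK; split=> [fK|[R fR RK]].
  pose rep (C : set G) := xget 1 [set x | left_coset K x = C].
  exists (rep @` range (left_coset K)); first exact: finite_image.
  move=> x; exists (rep (left_coset K x)); first by exists (left_coset K x).
  apply/left_coset_eqP => //.
  by apply: (@xgetI _ 1 [set y | left_coset K y = left_coset K x] x).
apply: (@sub_finite_set _ _ (left_coset K @` R)); last exact: finite_image.
move=> _ [x _ <-]; have [r Rr Kr] := RK x.
by exists r => //; apply/left_coset_eqP.
Qed.

Lemma expgzS x k : expgz x (k + 1)%R = expgz x k * x.
Proof.
case: k => n; first by rewrite -PoszD /= addn1 expgSr.
have -> : (Negz n + 1 = - n%:Z)%R by lia.
rewrite /= expgS invgM mulgVK.
by case: n => [|n] /=; rewrite ?invg1.
Qed.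

Lemma expgzD x k l : expgz x (k + l)%R = expgz x k * expgz x l.
Proof.
elim/int_rec: l => [|n IH|n IH]; first by rewrite GRing.addr0 mulg1.
  have -> : (n.+1%:Z = n%:Z + 1)%R by lia.
  by rewrite GRing.addrA !expgzS IH mulgA.
apply: (mulIg x); rewrite -mulgA -!expgzS -GRing.addrA.
by have -> : (- n.+1%:Z + 1 = - n%:Z)%R by lia.
Qed.

Lemma expgzN x k : expgz x (- k)%R = (expgz x k)^-1.
Proof.
by apply/esym/mulg1_eq; rewrite -expgzD GRing.addrN.
Qed.

Lemma expgz_sub K x k : is_subgroup K -> K x -> K (expgz x k).
Proof.
move=> [K1 KM KV] Kx.
have Kn n : K (x ^+ n) by elim: n => // n IH; rewrite expgS; exact: KM.
by case: k => n /=; [|apply: KV].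
Qed.

Lemma cyclic_quotientP K L : is_subgroup K ->
  cyclic_quotient L K <->
  exists2 x, L x & forall y, L y -> exists k, K ((expgz x k)^-1 * y).
Proof.
move=> sK; split=> -[x Lx xP]; exists x => // y /xP[k kP]; exists k.
  by apply/left_coset_eqP.
by apply/esym/left_coset_eqP.
Qed.

(** A subgroup P of the product of the integers with G is cyclic modulo its part
    of degree 0: its degrees form a subgroup of the integers, and any element
    whose degree generates that subgroup will do. *)
Lemma int_graded_cyclic (P : int -> G -> Prop) :
    P 0%R 1 ->
    (forall k l x y, P k x -> P l y -> P (k + l)%R (x * y)) ->
    (forall k x, P k x -> P (- k)%R x^-1) ->
  exists x, (exists k, P k x) /\
    forall l y, P l y -> exists q, P 0%R ((expgz x q)^-1 * y).
Proof.
move=> P1 PM PV.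
have Pz k x q : P k x -> P (k * q)%R (expgz x q).
  move=> Pkx; have Pn n : P (k * n%:Z)%R (x ^+ n).
    elim: n => [|n IH]; first by rewrite GRing.mulr0.
    have -> : (k * n.+1%:Z = k * n%:Z + k)%R by lia.
    by rewrite expgSr; exact: PM.
  case: q => n /=; first exact: Pn.
  by rewrite NegzE GRing.mulrN; apply: PV; exact: Pn.
pose I n := `[< (0 < n)%N /\ exists x, P (Posz n) x >].
have [exI|nP] := pselect (exists n, I n).
  case: (ex_minnP exI) => n /asboolP[n0 [x Px]] nmin.
  exists x; split; first by exists n.
  move=> l y Ply; exists (l %/ n)%Z.
  have := PM _ _ _ _ (PV _ _ (Pz _ _ (l %/ n)%Z Px)) Ply.
  rewrite {2}(divz_eq l n) [(n%:Z * _)%R]GRing.mulrC GRing.addKr.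
  have : (0 <= l %% n)%Z%R by apply: modz_ge0; lia.
  have : ((l %% n)%Z < n%:Z)%R by apply: ltz_pmod; lia.
  case: (l %% n)%Z => // -[|r] // rn _ Pr.
  have /nmin : I r.+1.
    by apply/asboolP; split=> //; eexists; exact: Pr.
  lia.
exists 1; split; first by exists 0%R.
move=> l y Ply; exists 0%R; rewrite invg1 mul1g.
suff -> : 0%R = l by [].
apply/eqP; apply/negPn/negP => l0; apply: nP; exists `|l|%N.
apply/asboolP; split; first lia.
case: (intP l) l0 Ply => // n _ Pn; first by exists y.
by exists y^-1; rewrite abszN -[Posz _]GRing.opprK; exact: PV.
Qed.

End Generation.

(** A choice is made only for those elements of F that have a solution at all,
    which spares the caller a prior selection of them. *)
Lemma finite_choice (T : Type) (G : groupType) (F : set T)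
    (Q : T -> G -> Prop) : finite_set F ->
  exists E, [/\ finite_set E, forall u, E u -> exists2 t, F t & Q t u &
    forall t, F t -> (exists u, Q t u) -> exists2 u, E u & Q t u].
Proof.
move=> finF; pose c t := xget 1 (Q t).
have cP t : (exists u, Q t u) -> Q t (c t).
  by move=> [u Qtu]; exact: (xgetI _ Qtu).
exists (c @` (F `&` [set t | exists u, Q t u])); split.
- exact/finite_image/finite_setIl.
- by move=> _ [t [Ft Qt] <-]; exists t => //; exact: cP.
by move=> t Ft Qt; exists (c t); [exists t|exact: cP].
Qed.

(** * Homomorphisms *)

Section Morphisms.
Variables (G H : groupType) (f : G -> H).
Hypothesis fM : {morph f : x y / x * y}.

Lemma morph_one : f 1 = 1.
Proof. by apply: (mulgI (f 1)); rewrite -fM !mulg1. Qed.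

Lemma morph_inv x : f x^-1 = (f x)^-1.
Proof. by apply/esym/mulg1_eq; rewrite -fM mulgV morph_one. Qed.

Lemma subgroup_preimage (K : set H) : is_subgroup K -> is_subgroup (f @^-1` K).
Proof.
move=> [K1 KM KV]; split=> [|x y Kx Ky|x Kx]; rewrite /preimage /=.
- by rewrite morph_one.
- by rewrite fM; exact: KM.
- by rewrite morph_inv; exact: KV.
Qed.

Lemma subgroup_image (K : set G) : is_subgroup K -> is_subgroup (f @` K).
Proof.
move=> [K1 KM KV]; split.
- by exists 1 => //; exact: morph_one.
- by move=> _ _ [x Kx <-] [y Ky <-]; exists (x * y); [exact: KM|exact: fM].
- by move=> _ [x Kx <-]; exists x^-1; [exact: KV|exact: morph_inv].
Qed.

Lemma normal_preimage (K L : set H) :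
  normal_in K L -> normal_in (f @^-1` K) (f @^-1` L).
Proof.
move=> [sK sL KL nK]; split; [exact: subgroup_preimage..| |].
  by move=> x; exact: KL.
by move=> x y Lx Ky; rewrite /preimage /= !fM morph_inv; exact: nK.
Qed.

(** A cyclic factor L / K stays cyclic when pulled back to a subgroup B: the
    exponents k such that f maps some element of B into x^k K form a subgroup of
    the integers. *)
Lemma subgroup_of_cyclic_quotient (K L : set H) (B : set G) :
    normal_in K L -> cyclic_quotient L K ->
    is_subgroup B -> B `<=` f @^-1` L ->
  exists2 t, B t & forall y, B y -> exists k, K (f ((expgz t k)^-1 * y)).
Proof.
move=> [sK sL KL nK] /(cyclic_quotientP _ sK)[x Lx xP] [B1 BM BV] BL.
have [K1 KM KV] := sK; have [L1 LM LV] := sL.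
pose P k y := B y /\ K ((expgz x k)^-1 * f y).
have Lxk k : L (expgz x k) by exact: expgz_sub.
have [| | |t [[k [Bt _]] tP]] := @int_graded_cyclic _ P.
- by split=> //; rewrite morph_one invg1 mulg1.
- move=> k l y z [By Ky] [Bz Kz]; split; first exact: BM.
  suff -> : (expgz x (k + l)%R)^-1 * f (y * z) =
    (expgz x l)^-1 * ((expgz x k)^-1 * f y) * ((expgz x l)^-1)^-1 *
    ((expgz x l)^-1 * f z) by apply: KM => //; apply: nK => //; exact: LV.
  by rewrite expgzD fM !gnorm.
- move=> k y [By Ky]; split; first exact: BV.
  suff -> : (expgz x (- k)%R)^-1 * f y^-1 =
    expgz x k * ((expgz x k)^-1 * f y)^-1 * (expgz x k)^-1.
    by apply: nK => //; exact: KV.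
  by rewrite expgzN morph_inv !gnorm.
exists t => // y By; have [|l Kl] := xP (f y); first exact: BL.
have [q [_]] := tP l y (conj By Kl).
by rewrite invg1 mul1g; exists q.
Qed.

End Morphisms.

(** * Polycyclic-by-finite groups are Noetherian *)

Section Noetherian.
Variable G : groupType.
Implicit Types (A B K L M F : set G) (x y : G).

Definition noetherian_subset A : Prop :=
  forall B, is_subgroup B -> B `<=` A -> finitely_generated B.

Lemma fg_extension B K F : is_subgroup B -> finite_set F -> F `<=` B ->
    (forall b, B b -> exists2 c, generated F c & K (c^-1 * b)) ->
  finitely_generated (B `&` K) -> finitely_generated B.
Proof.
move=> sB finF FB BFK /finitely_generatedP[E finE EBK].
have sFE := gen_subgroup (F `|` E).
have EB : E `<=` B by move=> e /sub_gen; rewrite EBK => -[].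
have gFB := gen_sub sB FB.
apply/finitely_generatedP; exists (F `|` E); first by rewrite finite_setU.
apply/seteqP; split; first by apply: gen_sub => // x [/FB|/EB].
move=> b Bb; have [c Fc Kcb] := BFK b Bb.
have [_ BM BV] := sB; have [_ FEM _] := sFE.
have : generated E (c^-1 * b).
  by rewrite EBK; split=> //; apply: BM => //; apply: BV; exact: gFB.
rewrite -(mulVKg c b) => Ecb; rewrite mulKg in Ecb.
apply: FEM.
  by apply: gen_sub Fc => // x Fx; apply: sub_gen; left.
by apply: gen_sub Ecb => // x Ex; apply: sub_gen; right.
Qed.

(** Elements that, together with their inverses, preserve C form a subgroup. *)
Lemma gen_stable (T : Type) (act : G -> T -> T) (C : set T) A :
    (forall c, act 1 c = c) ->
    (forall g h c, act (g * h) c = act g (act h c)) ->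
    (forall g c, A g -> C c -> C (act g c) /\ C (act g^-1 c)) ->
  forall g c, generated A g -> C c -> C (act g c).
Proof.
move=> act1 actM AC g x Ag Cx.
pose S := [set g | forall x : T, C x -> C (act g x) /\ C (act g^-1 x)].
have sS : is_subgroup S.
  split=> [y|g1 g2 S1 S2 y Cy|g1 S1 y Cy]; first by rewrite invg1 act1.
    rewrite invgM !actM; split; first by apply: (S1 _ _).1; exact: (S2 _ _).1.
    by apply: (S2 _ _).2; exact: (S1 _ _).2.
  by rewrite invgK; split; [exact: (S1 _ _).2|exact: (S1 _ _).1].
by apply: (gen_sub sS _ Ag _ Cx).1 => h Ah y; exact: AC.
Qed.

Lemma noetherian_subset1 : noetherian_subset [set 1 : G].
Proof.
move=> B sB B1; exists [::]; apply/seteqP; split; first exact: gen_sub.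
by move=> x /B1 ->; have [] := gen_subgroup [set` [::] : seq G].
Qed.

Lemma polycyclic_ind (P : set G -> Prop) :
    P [set 1] ->
    (forall K L, P K -> normal_in K L -> cyclic_quotient L K -> P L) ->
  forall A, polycyclic A -> P A.
Proof.
move=> P1 PS A [n [S [S0 <- SS]]].
elim: n SS => [|n IH] SS; first by rewrite S0.
have [nS cS] := SS n (ltnSn n).
by apply: PS nS cS; apply: IH => i lt_in; apply: SS; exact: ltnW.
Qed.

Lemma polycyclic1 : polycyclic [set 1 : G].
Proof. by exists 0%N, (fun=> [set 1]). Qed.

Lemma polycyclicS K L :
  polycyclic K -> normal_in K L -> cyclic_quotient L K -> polycyclic L.
Proof.
move=> [n [S [S0 Sn SS]]] nKL cKL.
pose S' i := if (i <= n)%N then S i else L.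
have S'n i : (i <= n)%N -> S' i = S i by rewrite /S' => ->.
have S'L : S' n.+1 = L by rewrite /S' ltnn.
exists n.+1, S'; split; [by rewrite S'n|exact: S'L|] => i.
rewrite ltnS leq_eqVlt => /predU1P[->|lt_in]; first by rewrite S'L S'n ?Sn.
by rewrite !S'n ?(ltnW lt_in) //; exact: SS.
Qed.

Lemma polycyclic_noetherian A : polycyclic A -> noetherian_subset A.
Proof.
apply: polycyclic_ind => [|K L nK nKL cKL B sB BL].
  exact: noetherian_subset1.
have [//|t Bt tP] :=
  @subgroup_of_cyclic_quotient _ _ id (fun _ _ => erefl) _ _ _ nKL cKL sB.
have [sK _ _ _] := nKL.
apply: (@fg_extension B K [set t]) => //.
- by move=> _ ->.
- move=> b /tP[k Kb]; exists (expgz t k) => //.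
  by apply: (expgz_sub _ (gen_subgroup _)); exact: sub_gen.
by apply: (nK _ (subgroupI sB sK)) => x [].
Qed.

Lemma polycyclic_by_finite_noetherian :
  polycyclic_by_finite G -> noetherian G.
Proof.
move=> [N [[sN _ _ _] /polycyclic_noetherian nN]].
move=> /(finite_indexP sN)[R finR RN] B sB.
have [E [finE EB RE]] :=
  finite_choice (fun r b => B b /\ N (r^-1 * b)) finR.
have [_ NM NV] := sN.
apply: (@fg_extension B N E) => //.
- by move=> e /EB[r _ []].
- move=> b Bb; have [r Rr Nrb] := RN b.
  have [|e Ee [_ Nre]] := RE r Rr; first by exists b.
  exists e; first exact: sub_gen.
  by have := NM _ _ (NV _ Nre) Nrb; rewrite !gnorm.
by apply: (nN _ (subgroupI sB sN)) => x [].
Qed.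

(** Schreier's lemma.  With R a transversal, let E consist of the elements
    r'^-1 g r that lie in K, for r, r' in R and g a generator or its inverse.
    Then R <E> is stable under left multiplication by the generators, hence is
    the whole group.  The elements of R that lie in K are added to E so that the
    representative of K itself does not matter. *)
Lemma finite_index_fg K : is_subgroup K -> finite_index K ->
  finitely_generated [set: G] -> finitely_generated K.
Proof.
move=> sK /(finite_indexP sK)[R finR RK] /finitely_generatedP[F finF FG].
have [K1 KM KV] := sK.
pose E1 := (fun p : G * G * G => p.1.1^-1 * p.1.2 * p.2) @`
  (R `*` (F `|` inv @` F) `*` R).
pose E := (E1 `|` R) `&` K.
have finE : finite_set E.
  apply/finite_setIl; rewrite finite_setU; split=> //; apply: finite_image.
  apply: finite_setX => //; apply: finite_setX => //.
  by rewrite finite_setU; split=> //; exact: finite_image.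
have sE := gen_subgroup E; have [E_1 EM EV] := sE.
have EK : generated E `<=` K by apply: gen_sub => // x [].
pose C := [set x | exists2 r, R r & generated E (r^-1 * x)].
have C1 : C 1.
  have [r Rr Kr] := RK 1; exists r => //; rewrite mulg1 in Kr *.
  apply: EV; apply: sub_gen; split; first by right.
  by rewrite -(invgK r); exact: KV.
have FC g x : (F `|` inv @` F) g -> C x -> C (g * x).
  move=> Fg [r Rr Erx]; have [r' Rr' Kr'] := RK (g * r); exists r' => //.
  rewrite -(mulVKg r x) !mulgA; rewrite -mulgA; apply: EM => //.
  by apply: sub_gen; split; [left; exists (r', g, r)|rewrite -mulgA].
have CT x : C x.
  rewrite -[x]mulg1.
  apply: (@gen_stable G (fun g y => g * y) C F) => //; last by rewrite FG.
  - exact: mul1g.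
  - by move=> ? ? ?; rewrite mulgA.
  - by move=> g y Fg Cy; split; apply: FC => //; [left|right; exists g].
apply/finitely_generatedP; exists E => //; apply/seteqP; split=> // x Kx.
have [r Rr Er] := CT x.
rewrite -(mulVKg r x); apply: EM => //; apply: sub_gen; split; first by right.
by have := KM _ _ Kx (KV _ (EK _ Er)); rewrite !gnorm.
Qed.

End Noetherian.

(** * Finitely generated central extensions *)

(** The elements phi v s, for s in F, and those of E are written w a with w in
    <F> and a in A.  The subgroup generated by F and the finitely many elements
    a that occur is stable, because the phi v do not move these a. *)
Lemma fg_stable_subgroup (T : groupType) (M A F E : set T)
    (V : Type) (U : set V) (phi : V -> T -> T) :
    is_subgroup M -> A `<=` M ->
    finite_set F -> F `<=` M ->
    (forall m, M m -> exists2 w, generated F w & A (w^-1 * m)) ->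
    finite_set E -> E `<=` M ->
    finite_set U ->
    (forall v, U v -> {morph phi v : x y / x * y}) ->
    (forall v, U v -> M `<=` phi v @^-1` M) ->
    (forall v a, U v -> A a -> phi v a = a) ->
  exists M0, [/\ is_subgroup M0, finitely_generated M0, M0 `<=` M, E `<=` M0 &
    forall v, U v -> M0 `<=` phi v @^-1` M0].
Proof.
move=> sM AM finF FM FA finE EM finU phiM phiMM phiA.
pose D := E `|` (fun p => phi p.1 p.2) @` (U `*` F).
have finD : finite_set D.
  by rewrite finite_setU; split=> //; apply/finite_image/finite_setX.
have DM : D `<=` M.
  by move=> x [/EM//|[[v y] [/= Uv Fy] <-]]; apply: phiMM => //; exact: FM.
have [B [finB BA DB]] :=
  finite_choice (fun m a => A a /\ exists2 w, generated F w & m = w * a) finD.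
have sFB := gen_subgroup (F `|` B); have [_ FBM _] := sFB.
have DFB : D `<=` generated (F `|` B).
  move=> d Dd; have [w Fw Aw] := FA _ (DM _ Dd).
  have [|b Bb [_ [u Fu ->]]] := DB d Dd.
    by exists (w^-1 * d); split=> //; exists w => //; rewrite mulVKg.
  apply: FBM; last by apply: sub_gen; right.
  by apply: gen_sub Fu => // x Fx; apply: sub_gen; left.
exists (generated (F `|` B)); split=> //.
- by apply/finitely_generatedP; exists (F `|` B) => //; rewrite finite_setU.
- by apply: gen_sub => // x [/FM//|/BA[y _ [Ax _]]]; exact: AM.
- by move=> e Ee; apply: DFB; left.
move=> v Uv; apply: gen_sub; first exact: (subgroup_preimage (phiM v Uv)).
move=> x [Fx|Bx]; first by apply: DFB; right; exists (v, x).
rewrite /preimage /= phiA //; first by apply: sub_gen; right.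
by have [y _ []] := BA _ Bx.
Qed.

Lemma centralizer_subgroup (T : groupType) (z : T) :
  is_subgroup [set y | y * z = z * y].
Proof.
split=> [|a b aC bC|a aC]; rewrite /= ?mulg1 ?mul1g //.
  by rewrite -mulgA bC mulgA aC mulgA.
by apply: (mulgI a); rewrite mulVKg mulgA aC mulgK.
Qed.

Lemma polycyclic_central_fg (T : groupType) (A : set T) :
    (forall a x, A a -> a * x = x * a) ->
  finitely_generated A -> polycyclic A.
Proof.
move=> cA [s gsA].
have sA : [set` s] `<=` A by move=> x sx; rewrite -gsA; exact: sub_gen.
rewrite -{}gsA; elim: s sA => [|x s IH] sA.
  have -> : generated [set` [::] : seq T] = [set 1]; last exact: polycyclic1.
  apply/seteqP; split; last first.
    by move=> _ ->; have [] := gen_subgroup [set` [::] : seq T].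
  apply: gen_sub => //; split=> // [_ _ -> ->|_ ->]; first exact: mulg1.
  exact: invg1.
set L := generated [set` x :: s]; pose K := generated [set` s].
have xsL : [set` x :: s] `<=` L by exact: sub_gen.
have sK : is_subgroup K by exact: gen_subgroup.
have sL : is_subgroup L by exact: gen_subgroup.
have [K1 KM KV] := sK.
have Ax : A x by apply: sA; exact: mem_head.
have KL : K `<=` L.
  by apply: gen_sub => // y sy; apply: xsL; rewrite /= in_cons sy orbT.
have cK y z : K y -> y * z = z * y.
  apply: (gen_sub (centralizer_subgroup z)) => a sa; apply: cA; apply: sA.
  by rewrite /= in_cons sa orbT.
apply: (@polycyclicS _ K).
- by apply: IH => y sy; apply: sA; rewrite /= in_cons sy orbT.
- by split=> // y z Ly Kz; rewrite -(cK z y Kz) mulgK.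
apply/cyclic_quotientP => //.
exists x; first by apply: xsL; exact: mem_head.
have cx k z : (expgz x k)^-1 * z = z * (expgz x k)^-1.
  by rewrite -expgzN; apply: (expgz_sub _ (centralizer_subgroup z)); exact: cA.
apply: gen_sub.
  split.
  - by exists 0%R; rewrite invg1 mulg1.
  - move=> y z [k Ky] [l Kz]; exists (k + l)%R; rewrite expgzD invgM.
    by rewrite -mulgA [X in _ * X]mulgA mulgA (cx l) -mulgA; exact: KM.
  - move=> y [k Ky]; exists (- k)%R; rewrite expgzN -invgM -cx.
    exact: KV.
move=> y; rewrite /= in_cons => /predU1P[->|sy].
  by exists 1%R; rewrite mulVg.
by exists 0%R; rewrite invg1 mul1g; exact: sub_gen.
Qed.

Section CentralExtension.
Variables (T G : groupType) (f : T -> G).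
Hypothesis fM : {morph f : x y / x * y}.
Hypothesis noethG : noetherian G.

Lemma lift_generators (M : set T) : is_subgroup M ->
  exists F, [/\ finite_set F, F `<=` M &
    forall m, M m -> exists2 w, generated F w & f (w^-1 * m) = 1].
Proof.
move=> sM; have sfM := subgroup_image fM sM.
have /finitely_generatedP[F' finF' F'fM] := noethG sfM.
have [F [finF FF' F'F]] := finite_choice (fun x t => M t /\ f t = x) finF'.
exists F; split=> // [t /FF'[_ _ []]//|m Mm].
have sfF := subgroup_image fM (gen_subgroup F).
have F'fF : F' `<=` f @` generated F.
  move=> x F'x; have [y My fy] : (f @` M) x by rewrite -F'fM; exact: sub_gen.
  have [|t Ft [_ <-]] := F'F x F'x; first by exists y.
  by exists t => //; exact: sub_gen.
have [|w Fw fw] := gen_sub sfF F'fF (t := f m); first by rewrite F'fM; exists m.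
by exists w; rewrite // fM (morph_inv fM) fw mulVg.
Qed.

Hypothesis centf : forall a x, f a = 1 -> a * x = x * a.

(** Finite generation passes down a cyclic step.  The subgroup M0 of f^-1(K) is
    stable under conjugation by the powers of t, so <t> M0 is a group, and it
    contains the generators of f^-1(L).  Hence an element of f^-1(K) is t^k m
    with m in M0 and t^k in f^-1(K); as M0 also contains a generator z of
    the intersection of <t> with f^-1(K), it is the whole of f^-1(K). *)
Lemma fg_preimage_normal (K L : set G) :
    normal_in K L -> cyclic_quotient L K ->
  finitely_generated (f @^-1` L) -> finitely_generated (f @^-1` K).
Proof.
move=> nKL cKL /finitely_generatedP[F finF FL].
have [sfK sfL KL nK] := normal_preimage fM nKL.
have [K1 KM KV] := sfK.
have [//|t Lt tP] := subgroup_of_cyclic_quotient fM nKL cKL sfL.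
have [F0 [finF0 F0K F0P]] := lift_generators sfK.
(* z generates the intersection of <t> with f^-1(K). *)
pose P k y := (f @^-1` K) y /\ y = expgz t k.
have [| | |z [[kz [Kz _]] zP]] := @int_graded_cyclic T P.
- by split.
- move=> k l x y [Kx xk] [Ky yl].
  by split; [exact: KM|rewrite expgzD -xk -yl].
- by move=> k x [Kx xk]; split; [exact: KV|rewrite expgzN -xk].
have [E [finE EK FE]] := finite_choice
  (fun y m => (f @^-1` K) m /\ exists k, y = expgz t k * m) finF.
pose phi (x y : T) := x * y * x^-1.
have conjA x a : f a = 1 -> phi x a = a.
  by move=> fa; rewrite /phi -(centf x fa) mulgK.
have [|||||||||||M0 [sM0 fgM0 M0K EM0 phiM0]] := @fg_stable_subgroup T (f @^-1` K)
  (f @^-1` [set 1]) F0 ([set z] `|` E) T [set t; t^-1] phi => //.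
- by move=> a fa; rewrite /preimage /= fa; case: nKL => -[].
- by rewrite finite_setU.
- by move=> m [->//|/EK[y _ [Km _]]].
- by move=> x _ y1 y2; rewrite /phi !gnorm.
- move=> x xt y Ky; apply: nK => //; case: xt => ->//.
  by case: sfL => _ _; exact.
- by move=> x a _; exact: conjA.
have [M01 M0M M0V] := sM0.
have phik k y : M0 y -> M0 (phi (expgz t k) y).
  apply: (@gen_stable _ _ phi M0 [set t]).
  - by move=> c; rewrite /phi invg1 mul1g mulg1.
  - by move=> g h c; rewrite /phi !gnorm.
  - by move=> _ c -> Mc; split; apply: phiM0 => //; [left|right].
  by apply: (expgz_sub _ (gen_subgroup _)); exact: sub_gen.
suff <- : M0 = f @^-1` K by [].
apply/seteqP; split=> // y Ky.
have sS : is_subgroup [set y | exists k m, M0 m /\ y = expgz t k * m].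
  split.
  - by exists 0%R, 1; rewrite mulg1.
  - move=> _ _ [k [m [Mm ->]]] [l [n [Mn ->]]].
    exists (k + l)%R, (phi (expgz t (- l)%R) m * n).
    by split; [apply: M0M => //; exact: phik|rewrite /phi expgzD expgzN !gnorm].
  - move=> _ [k [m [Mm ->]]]; exists (- k)%R, (phi (expgz t k) m^-1).
    by split; [apply: phik; exact: M0V|rewrite /phi expgzN !gnorm].
have Ly : generated F y by rewrite FL; exact: KL.
have [|k [m [Mm y_tm]]] := gen_sub sS _ Ly.
  move=> x Fx; have Lx : (f @^-1` L) x by rewrite -FL; exact: sub_gen.
  have [k Kk] := tP x Lx.
  have [|m Em [_ [l x_tm]]] := FE x Fx.
    by exists ((expgz t k)^-1 * x); split=> //; exists k; rewrite mulVKg.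
  by exists l, m; split=> //; apply: EM0; right.
have Ktk : (f @^-1` K) (expgz t k).
  by rewrite -(mulgK m (expgz t k)) -y_tm; apply: KM => //; apply: KV; exact: M0K.
have [q [_ /= z_tk]] := zP k _ (conj Ktk erefl).
rewrite y_tm -(mulVKg (expgz z q) (expgz t k)) z_tk mulg1.
by apply: M0M => //; apply: expgz_sub => //; apply: EM0; left.
Qed.

(** The induction carries finite generation from L down to the kernel by
    [fg_preimage_normal] and builds the series on the way back up. *)
Lemma polycyclic_preimage (K : set G) : polycyclic K ->
  finitely_generated (f @^-1` K) -> polycyclic (f @^-1` K).
Proof.
move=> pK; move: K pK.
apply: polycyclic_ind => [fgA|K L IH nKL cKL fgL].
  by apply: polycyclic_central_fg => // a x fa; exact: centf.
have nfKL := normal_preimage fM nKL; have [sfK sfL KL _] := nfKL.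
apply: (polycyclicS (IH (fg_preimage_normal nKL cKL fgL)) nfKL).
apply/cyclic_quotientP => //.
exact: (subgroup_of_cyclic_quotient fM nKL cKL sfL).
Qed.

End CentralExtension.

Theorem central_extension_polycyclic_by_finite (T G : groupType) (f : T -> G) :
    {morph f : x y / x * y} -> (forall a x, f a = 1 -> a * x = x * a) ->
    finitely_generated [set: T] -> polycyclic_by_finite G ->
  polycyclic_by_finite T.
Proof.
move=> fM centf fgT pG; have nG := polycyclic_by_finite_noetherian pG.
have [N [nN pN /finite_indexP iN]] := pG.
have [sN _ _ _] := nN; have [_ NM NV] := sN.
have nfN := normal_preimage fM nN.
have sfN := subgroup_preimage fM sN.
have ifN : finite_index (f @^-1` N).
  have [R finR RN] := iN sN.
  have [R' [finR' _ R'R]] := finite_choice (fun r t => N (r^-1 * f t)) finR.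
  apply/finite_indexP => //; exists R' => // x.
  have [r Rr Nrx] := RN (f x); have [|t R't Nrt] := R'R r Rr; first by exists x.
  exists t => //; rewrite /preimage /= fM (morph_inv fM).
  by have := NM _ _ (NV _ Nrt) Nrx; rewrite !gnorm.
exists (f @^-1` N); split=> //.
by apply: polycyclic_preimage => //; exact: finite_index_fg.
Qed.

(** * Homomorphisms from a group given by a presentation *)

Section PresentedMorphisms.
Variables (X : Type) (R : gterm X -> gterm X -> Prop).
Local Open Scope quotient_scope.

Fixpoint gterm_eval (K : groupType) (g : X -> K) (s : gterm X) : K :=
  match s with
  | TGen x => g x
  | TOne => 1
  | TMul s t => gterm_eval g s * gterm_eval g t
  | TInv s => (gterm_eval g s)^-1
  end.

Definition presented_gen (x : X) : presented R :=
  \pi_({eq_quot gcong_equiv R}) (TGen x).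

Definition presented_lift (K : groupType) (g : X -> K) (a : presented R) : K :=
  gterm_eval g (repr (a : {eq_quot gcong_equiv R})).

Lemma pi_gterm s :
  \pi_({eq_quot gcong_equiv R}) s = gterm_eval presented_gen s :> presented R.
Proof.
elim: s => // [s IHs t IHt|s IHs] /=; first by rewrite -IHs -IHt -cls_mul.
by rewrite -IHs -cls_inv.
Qed.

Lemma presented_rel s t : R s t ->
  gterm_eval presented_gen s = gterm_eval presented_gen t.
Proof. by move=> Rst; rewrite -!pi_gterm; apply/clsP; exact: gcong_rel. Qed.

Lemma presented_sub (S : set (presented R)) : is_subgroup S ->
  (forall x, S (presented_gen x)) -> forall a, S a.
Proof.
move=> [S1 SM SV] Sgen; elim/presentedW=> s; rewrite pi_gterm.
by elim: s => //= [s Ss t St|s Ss]; [exact: SM|exact: SV].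
Qed.

Section Lift.
Variables (K : groupType) (g : X -> K).
Hypothesis gR : forall s t, R s t -> gterm_eval g s = gterm_eval g t.

Lemma gterm_eval_cong s t : gcong R s t -> gterm_eval g s = gterm_eval g t.
Proof.
elim=> {s t} //=.
- by move=> s t u _ -> _ ->.
- by move=> s s' t t' _ -> _ ->.
- by move=> s s' _ ->.
- by move=> s t u; exact: mulgA.
- by move=> s; exact: mul1g.
- by move=> s; exact: mulg1.
- by move=> s; exact: mulVg.
- by move=> s; exact: mulgV.
Qed.

Lemma presented_lift_gen x : presented_lift g (presented_gen x) = g x.
Proof. exact: (gterm_eval_cong (gcong_repr R (TGen x))). Qed.

Lemma presented_liftM : {morph presented_lift g : a b / a * b}.
Proof. by move=> a b; exact: (gterm_eval_cong (gcong_repr R (TMul _ _))). Qed.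

End Lift.

Lemma presented_ext (K : groupType) (f g : presented R -> K) :
    {morph f : a b / a * b} -> {morph g : a b / a * b} ->
  (forall x, f (presented_gen x) = g (presented_gen x)) -> f =1 g.
Proof.
move=> fM gM fg; apply: (@presented_sub [set a | f a = g a] _ fg); split=> /=.
- by rewrite (morph_one fM) (morph_one gM).
- by move=> a b fga fgb; rewrite fM gM fga fgb.
- by move=> a fga; rewrite (morph_inv fM) (morph_inv gM) fga.
Qed.

End PresentedMorphisms.

(** * The non-abelian tensor product *)

Section Tensor.
Variables (G H : groupType) (actGH : G -> H -> H) (actHG : H -> G -> G).
Hypothesis actGHP : acts_by_automorphisms actGH.
Hypothesis actHGP : acts_by_automorphisms actHG.
Hypothesis compatGH : compatible actGH actHG.

Local Notation T := (nonabelian_tensor actGH actHG).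
Implicit Types (g a b : G) (h c d : H) (s t : T).

Definition tens g h : T := presented_gen (@tensor_relation _ _ actGH actHG) (g, h).
Local Notation "g ⊗ h" := (tens g h) (at level 40).

Let act1 : forall h, actGH 1 h = h. Proof. by case: actGHP. Qed.
Let actM : forall g g' h, actGH (g * g') h = actGH g (actGH g' h).
Proof. by case: actGHP. Qed.
Let actgM g : {morph actGH g : h h' / h * h'}.
Proof. by case: actGHP => _ _ aut h h'; exact: aut. Qed.
Let act'1 : forall g, actHG 1 g = g. Proof. by case: actHGP. Qed.
Let act'M : forall h h' g, actHG (h * h') g = actHG h (actHG h' g).
Proof. by case: actHGP. Qed.
Let acthM h : {morph actHG h : g g' / g * g'}.
Proof. by case: actHGP => _ _ aut g g'; exact: aut. Qed.
Let acthV h := morph_inv (@acthM h).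

Let compat_conj h g k :
  h * actGH g k * h^-1 = actGH (actHG h g) (h * k * h^-1).
Proof. by rewrite compatGH.1 !gnorm. Qed.

Let compat_conj' g h k :
  g * actHG h k * g^-1 = actHG (actGH g h) (g * k * g^-1).
Proof. by rewrite compatGH.2 !gnorm. Qed.

Lemma tens_mull a b h : (a * b) ⊗ h = (a * b * a^-1) ⊗ actGH a h * (a ⊗ h).
Proof. exact: (presented_rel (tensor_mull actGH actHG a b h)). Qed.

Lemma tens_mulr g c d : g ⊗ (c * d) = g ⊗ c * (actHG c g ⊗ (c * d * c^-1)).
Proof. exact: (presented_rel (tensor_mulr actGH actHG g c d)). Qed.

(** The defining relation with a b = b (b^-1 a b): the action falls on the second
    factor only, so generating the first factor by a set X is enough. *)
Lemma tens_mull_swap a b h : (a * b) ⊗ h = a ⊗ actGH b h * (b ⊗ h).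
Proof. by have := tens_mull b (b^-1 * a * b) h; rewrite !gnorm. Qed.

Lemma tens1 h : 1 ⊗ h = 1.
Proof.
have := tens_mull_swap 1 1 h; rewrite mulg1 act1 => hh.
by apply: (mulIg (1 ⊗ h)); rewrite -hh mul1g.
Qed.

Definition tensor_map (al : G -> G) (be : H -> H) : T -> T :=
  presented_lift (fun p : G * H => al p.1 ⊗ be p.2).

Section Functoriality.
Variables (al : G -> G) (be : H -> H).
Hypothesis alM : {morph al : a b / a * b}.
Hypothesis beM : {morph be : c d / c * d}.
Hypothesis al_act : forall h g, al (actHG h g) = actHG (be h) (al g).
Hypothesis be_act : forall g h, be (actGH g h) = actGH (al g) (be h).

Let tensor_map_rel (s t : gterm (G * H)) : tensor_relation actGH actHG s t ->
  gterm_eval (fun p : G * H => al p.1 ⊗ be p.2) s =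
  gterm_eval (fun p : G * H => al p.1 ⊗ be p.2) t.
Proof.
case=> [a b h|g c d] /=.
  by rewrite be_act !alM (morph_inv alM) tens_mull.
by rewrite al_act !beM (morph_inv beM) tens_mulr.
Qed.

Lemma tensor_mapE g h : tensor_map al be (g ⊗ h) = al g ⊗ be h.
Proof. exact: (presented_lift_gen tensor_map_rel). Qed.

Lemma tensor_mapM : {morph tensor_map al be : s t / s * t}.
Proof. exact: (presented_liftM tensor_map_rel). Qed.

End Functoriality.

Definition actGT g := tensor_map (fun a => g * a * g^-1) (actGH g).
Definition actHT h := tensor_map (actHG h) (fun d => h * d * h^-1).

Lemma actGTE g a h : actGT g (a ⊗ h) = (g * a * g^-1) ⊗ actGH g h.
Proof.
by apply: tensor_mapE => // [a1 a2|b k]; rewrite -?actM !gnorm.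
Qed.

Lemma actGTM g : {morph actGT g : s t / s * t}.
Proof.
by apply: tensor_mapM => // [a1 a2|b k]; rewrite -?actM !gnorm.
Qed.

Lemma actHTE h g d : actHT h (g ⊗ d) = actHG h g ⊗ (h * d * h^-1).
Proof.
by apply: tensor_mapE => // [d1 d2|k b]; rewrite -?act'M !gnorm.
Qed.

Lemma actHTM h : {morph actHT h : s t / s * t}.
Proof.
by apply: tensor_mapM => // [d1 d2|k b]; rewrite -?act'M !gnorm.
Qed.

Let compM (f1 f2 : T -> T) : {morph f1 : s t / s * t} ->
  {morph f2 : s t / s * t} -> {morph f1 \o f2 : s t / s * t}.
Proof. by move=> M1 M2 s t; rewrite /= M2 M1. Qed.

Lemma actGT1 : actGT 1 =1 id.
Proof.
apply: presented_ext => // [|[g h]]; first exact: actGTM.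
by rewrite [LHS]actGTE act1 !gnorm.
Qed.

Lemma actGT_mul g g' : actGT (g * g') =1 actGT g \o actGT g'.
Proof.
apply: presented_ext => [||[a h]]; [exact: actGTM|exact/compM/actGTM/actGTM|].
by rewrite [LHS]actGTE /= !actGTE actM !gnorm.
Qed.

Lemma actHT1 : actHT 1 =1 id.
Proof.
apply: presented_ext => // [|[g h]]; first exact: actHTM.
by rewrite [LHS]actHTE act'1 !gnorm.
Qed.

Lemma actHT_mul h h' : actHT (h * h') =1 actHT h \o actHT h'.
Proof.
apply: presented_ext => [||[a d]]; [exact: actHTM|exact/compM/actHTM/actHTM|].
by rewrite [LHS]actHTE /= !actHTE act'M !gnorm.
Qed.

(** This is how the relation ^(^h g) = h g h^-1 between operators, which is what
    compatibility says on G and H, reads on T. *)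
Lemma actHT_actGT h g s : actHT h (actGT g s) = actGT (actHG h g) (actHT h s).
Proof.
move: s; apply: presented_ext => [||[a d]].
- exact: (compM (@actHTM h) (@actGTM g)).
- exact: (compM (@actGTM (actHG h g)) (@actHTM h)).
by rewrite /= !(actGTE, actHTE) compat_conj !acthM acthV.
Qed.

Lemma tens_mull_act a b h : (a * b) ⊗ h = actGT a (b ⊗ h) * (a ⊗ h).
Proof. by rewrite actGTE tens_mull. Qed.

Lemma tens_mulr_act g c d : g ⊗ (c * d) = g ⊗ c * actHT c (g ⊗ d).
Proof. by rewrite actHTE tens_mulr. Qed.

(** For s = b ⊗ d both sides occur when (ab) ⊗ (cd) is expanded, in the one case
    first on the left and in the other first on the right. *)
Lemma tens_act_comm a c s :
  a ⊗ c * actHT c (actGT a s) = actGT a (actHT c s) * (a ⊗ c).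
Proof.
suff -> : actHT c (actGT a s) = (a ⊗ c)^-1 * actGT a (actHT c s) * (a ⊗ c).
  by rewrite !gnorm.
move: s; apply: presented_ext => [s t|s t|[b d]].
- by rewrite actGTM actHTM.
- by rewrite actHTM actGTM !gnorm.
have := tens_mulr_act (a * b) c d; rewrite !tens_mull_act.
rewrite (tens_mulr_act b) (tens_mulr_act a c) actGTM actHTM !mulgA.
move/mulIg; rewrite -!mulgA => /mulgI E.
by rewrite -[presented_gen _ _]/(b ⊗ d) E mulKg.
Qed.

Definition tensor_to_left : T -> G :=
  presented_lift (fun p : G * H => p.1 * (actHG p.2 p.1)^-1).
Local Notation lam := tensor_to_left.

Let tensor_to_left_rel (s t : gterm (G * H)) : tensor_relation actGH actHG s t ->
  gterm_eval (fun p : G * H => p.1 * (actHG p.2 p.1)^-1) s =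
  gterm_eval (fun p : G * H => p.1 * (actHG p.2 p.1)^-1) t.
Proof.
case=> [a b h|g c d] /=; first by rewrite -compat_conj' acthM !gnorm.
by rewrite -act'M mulgVK act'M !gnorm.
Qed.

Lemma tensor_to_leftE g h : lam (g ⊗ h) = g * (actHG h g)^-1.
Proof. exact: (presented_lift_gen tensor_to_left_rel). Qed.

Lemma tensor_to_leftM : {morph lam : s t / s * t}.
Proof. exact: (presented_liftM tensor_to_left_rel). Qed.

(** By [tens_act_comm], conjugation by g ⊗ h is the action of the commutator of
    g and h as operators, which is the action of g (^h g)^-1 by
    [actHT_actGT]. *)
Lemma tens_conj g h s : g ⊗ h * s = actGT (lam (g ⊗ h)) s * (g ⊗ h).
Proof.
have key u : g ⊗ h * actGT (actHG h g) u = actGT g u * (g ⊗ h).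
  (* actHT h is onto, so every u has the form actHT h s. *)
  have := tens_act_comm g h (actHT h^-1 u).
  rewrite actHT_actGT -[actHT h (actHT _ u)]/((actHT h \o actHT h^-1) u).
  by rewrite -actHT_mul mulgV actHT1.
rewrite tensor_to_leftE actGT_mul -key.
rewrite -[actGT _ (actGT _ s)]/((actGT _ \o actGT _) s) -actGT_mul.
by rewrite mulgV actGT1.
Qed.

(** With the action of G on T, lam is a crossed module: this is its Peiffer
    identity. *)
Lemma tensor_conj t s : t * s = actGT (lam t) s * t.
Proof.
move: t s; pose S := [set t | forall s, t * s = actGT (lam t) s * t].
apply: (@presented_sub _ _ S); last by case=> g h s; exact: tens_conj.
split=> [s|t u tS uS s|t tS s].
- by rewrite (morph_one tensor_to_leftM) actGT1 mulg1 mul1g.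
- by rewrite tensor_to_leftM actGT_mul -mulgA uS mulgA tS mulgA.
apply: (mulgI t); rewrite mulVKg mulgA tS.
rewrite -[actGT _ (actGT _ s)]/((actGT _ \o actGT _) s) -actGT_mul.
by rewrite -tensor_to_leftM mulgV (morph_one tensor_to_leftM) actGT1 mulgK.
Qed.

Lemma tensor_kernel_central t s : lam t = 1 -> t * s = s * t.
Proof. by move=> lam_t; rewrite tensor_conj lam_t actGT1. Qed.

(** The formula lam(t) ⊗ h = t (^h t)^-1.  Both sides are multiplicative in t up
    to the same twist, by [tensor_conj].  For t = g ⊗ k, expanding
    (g * ^k g^-1) ⊗ h brings in ^k g^-1 ⊗ h, which is computed from the two
    factorisations of h k as h times k and as k times k^-1 h k. *)
Lemma tens_to_left t h : lam t ⊗ h * actHT h t = t.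
Proof.
move: t; pose S := [set t | lam t ⊗ h * actHT h t = t].
apply: (@presented_sub _ _ S).
  split=> [|s t|t]; rewrite /S /=.
  - by rewrite (morph_one tensor_to_leftM) tens1 (morph_one (@actHTM h)) mulg1.
  - move=> Ss St; rewrite tensor_to_leftM tens_mull_act actHTM.
    by rewrite -mulgA [X in _ * X]mulgA Ss mulgA -tensor_conj -mulgA St.
  - move=> St; have E : t * (lam t^-1 ⊗ h) = actHT h t.
      rewrite tensor_conj -[X in _ * X = _]St mulgA -tens_mull_act.
      by rewrite -tensor_to_leftM mulgV (morph_one tensor_to_leftM) tens1 mul1g.
    apply: (mulgI t); rewrite mulgA E -actHTM mulgV.
    exact: (morph_one (@actHTM h)).
case=> g k; rewrite /S /= -[presented_gen _ _]/(g ⊗ k).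
have actV d : actGT g (g^-1 ⊗ d) = (g ⊗ d)^-1.
  have := tens_mull_act g g^-1 d; rewrite mulgV tens1 => /esym E.
  by apply: (mulIg (g ⊗ d)); rewrite E mulVg.
have swap : actHG k g^-1 ⊗ h =
    (g^-1 ⊗ k)^-1 * (g^-1 ⊗ h) * actHT h (g^-1 ⊗ k).
  have := tens_mulr_act g^-1 k (k^-1 * h * k); rewrite actHTE !gnorm.
  by rewrite tens_mulr_act => E; rewrite -mulgA E mulKg.
rewrite tensor_to_leftE -acthV tens_mull_act swap !actGTM.
rewrite (morph_inv (@actGTM g)) !actV invgK -!mulgA.
rewrite [X in _ * (_ * X)]mulgA -tens_act_comm actV -mulgA -actHTM mulVg.
by rewrite (morph_one (@actHTM h)) mulg1 mulVg mulg1.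
Qed.

Lemma actHT_kernel t h : lam t = 1 -> actHT h t = t.
Proof. by move=> lt; rewrite -[RHS](tens_to_left t h) lt tens1 mul1g. Qed.

(** A subgroup M that contains x ⊗ y for generators x and y, and that H
    preserves, is all of T; H fixes ker lam pointwise and lam(T) is finitely
    generated, so [fg_stable_subgroup] provides a finitely generated one. *)
Lemma tensor_fg : finitely_generated [set: G] -> finitely_generated [set: H] ->
  noetherian G -> finitely_generated [set: T].
Proof.
move=> /finitely_generatedP[X finX XG] /finitely_generatedP[Y finY YH] nG.
have sT : is_subgroup [set: T] by split.
have [F [finF _ FT]] := lift_generators tensor_to_leftM nG sT.
have [||||||||||| M [sM fgM _ EM YM]] := @fg_stable_subgroup T setT
  (lam @^-1` [set 1]) F ((fun p => p.1 ⊗ p.2) @` (X `*` Y)) H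
  (Y `|` inv @` Y) actHT => //.
- exact/finite_image/finite_setX.
- by rewrite finite_setU; split=> //; exact: finite_image.
- by move=> h _; exact: actHTM.
- by move=> h t _; exact: actHT_kernel.
have [M1 MM MV] := sM.
have HM h t : M t -> M (actHT h t).
  move=> Mt; apply: (@gen_stable _ _ actHT M Y) => //.
  - exact: actHT1.
  - by move=> ? ? ?; rewrite actHT_mul.
  - move=> y u Yy Mu; split; first by apply: YM => //; left.
    by apply: YM => //; right; exists y.
  - by rewrite YH.
have XM x h : X x -> M (x ⊗ h).
  move=> Xx; have sS : is_subgroup [set h | M (x ⊗ h)].
    have x1 : x ⊗ 1 = 1.
      have := tens_mulr_act x 1 1; rewrite mulg1 actHT1 => xx.
      by apply: (mulgI (x ⊗ 1)); rewrite -xx mulg1.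
    split=> [|c d Mc Md|c Mc] /=; first by rewrite x1.
      by rewrite tens_mulr_act; apply: MM => //; exact: HM.
    have := tens_mulr_act x c c^-1; rewrite mulgV x1 => /esym/mulg1_eq cV.
    rewrite -[x ⊗ c^-1]actHT1 -(mulVg c) actHT_mul /= -cV.
    by apply: HM; exact: MV.
  have : generated Y h by rewrite YH.
  apply: (gen_sub sS) => y Yy; apply: EM; by exists (x, y).
have GM g h : M (g ⊗ h).
  have sS : is_subgroup [set g | forall h, M (g ⊗ h)].
    split=> [k|a b Ma Mb k|a Ma k]; first by rewrite tens1.
      by rewrite tens_mull_swap; exact: MM.
    have := tens_mull_swap a^-1 a (actGH a^-1 k).
    rewrite mulVg tens1 -actM mulgV act1.
    by move=> /esym/mulg1_eq aV; rewrite -(invgK (a^-1 ⊗ k)) aV; exact: MV.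
  have : generated X g by rewrite XG.
  by move=> /(gen_sub sS); apply => x Xx k; exact: XM.
suff -> : setT = M by [].
by apply/seteqP; split=> // t _; apply: presented_sub => // -[g h]; exact: GM.
Qed.

End Tensor.

Theorem theorem5p11 (G H : groupType)
    (actGH : G -> H -> H) (actHG : H -> G -> G)
    (actGHP : acts_by_automorphisms actGH)
    (actHGP : acts_by_automorphisms actHG)
    (compatGH : compatible actGH actHG)
    (polyG : polycyclic_by_finite G) (polyH : polycyclic_by_finite H) :
  polycyclic_by_finite (nonabelian_tensor actGH actHG) /\
  noetherian (nonabelian_tensor actGH actHG).
Proof.
have nG := polycyclic_by_finite_noetherian polyG.
have nH := polycyclic_by_finite_noetherian polyH.
have sT (K : groupType) : is_subgroup [set: K] by split.
suff pT : polycyclic_by_finite (nonabelian_tensor actGH actHG).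
  by split=> //; exact: polycyclic_by_finite_noetherian.
apply: (@central_extension_polycyclic_by_finite _ G
  (@tensor_to_left _ _ actGH actHG)) => //.
- exact: tensor_to_leftM.
- by move=> t s; exact: tensor_kernel_central.
apply: tensor_fg => //; [exact: nG|exact: nH].
Qed.
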